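(* Let $k\geq 3$ and let $\mathcal{G}$ be a $k$-uniform supertree of order $n$ with $m(\mathcal{G})\geq 3$ edges such that $\mathcal{G}\ncong \mathcal{S}^{\ast}(n, k)$. Then $\rho(\mathcal{G})\leq\rho\big(\mathcal{S}(n, k; \tfrac{n-1}{k-1}-2, 1)\big)$, with equality if and only if $\mathcal{G}\cong \mathcal{S}(n, k; \frac{n-1}{k-1}-2, 1)$.
   Context: A hypergraph $\mathcal{G}=(V,E)$ has a nonempty finite vertex set $V$ and a set $E$ of distinct edges, each a subset of $V$ with at least two vertices; $n=|V|$ is the order, $m(\mathcal{G})=|E|$. It is $k$-uniform if all edges have $k$ vertices. Its adjacency matrix $\mathcal{A}_{\mathcal{G}}$ has $(\mathcal{A}_{\mathcal{G}})_{ij}=\sum_{e\in E,\ i,j\in e}\frac{1}{|e|-1}$ for $i\neq j$ and $0$ on the diagonal; $\rho(\mathcal{G})$ is the largest modulus of an eigenvalue of $\mathcal{A}_{\mathcal{G}}$. A supertree is a connected hypergraph containing no (Berge) cycle $v_1e_1v_2\cdots v_qe_qv_1$ ($q\ge2$, distinct vertices, distinct edges, $v_i,v_{i+1}\in e_i$ indices mod $q$); any two edges of a supertree share at most one vertex and a $k$-uniform supertree of order $n$ has $\frac{n-1}{k-1}$ edges. A pendant edge is an edge in which at most one vertex has degree greater than one (degree = number of edges containing the vertex). The superstar $\mathcal{S}^{\ast}(n,k)$ is the $k$-uniform supertree of order $n$ whose edges all contain a common vertex. For $l_1,l_2\ge1$, the double hyperstar $\mathcal{S}(n,k;l_1,l_2)$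 is the $k$-uniform supertree of order $n$ obtained from an edge $e$ with two distinct vertices $u_1,u_2\in e$ by attaching $l_1$ pendant edges at $u_1$ and $l_2$ pendant edges at $u_2$ (each attached edge meets the rest only in its attachment vertex). *)

(* Defs.v *)
From HB Require Import structures.
From mathcomp Require Import all_boot all_order all_algebra.
From mathcomp Require Import fingroup perm algC.
Set Implicit Arguments. Unset Strict Implicit. Unset Printing Implicit Defensive.
Import Order.TTheory GRing.Theory Num.Theory.
Local Open Scope ring_scope.

(* A hypergraph of order n has vertex set 'I_n and edge
   set E : {set {set 'I_n}} (distinct edges automatically). *)

Definition hypergraph n (E : {set {set 'I_n}}) : Prop :=
  (0 < n)%N /\ forall e, e \in E -> (2 <= #|e|)%N.

Definition uniform n (k : nat) (E : {set {set 'I_n}}) : Prop :=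
  forall e, e \in E -> #|e| = k.

Definition hadj n (E : {set {set 'I_n}}) : rel 'I_n :=
  fun u v => [exists e in E, (u \in e) && (v \in e)].

Definition hconnected n (E : {set {set 'I_n}}) : Prop :=
  forall u v : 'I_n, connect (hadj E) u v.

Definition berge_cycle n (E : {set {set 'I_n}}) : Prop :=
  exists (q : nat) (v : nat -> 'I_n) (f : nat -> {set 'I_n}),
    [/\ (2 <= q)%N,
        (forall i j, (i < q)%N -> (j < q)%N -> v i = v j -> i = j),
        (forall i j, (i < q)%N -> (j < q)%N -> f i = f j -> i = j) &
        (forall i, (i < q)%N ->
           [/\ f i \in E, v i \in f i & v (i.+1 %% q)%N \in f i])].

Definition supertree n (E : {set {set 'I_n}}) : Prop :=
  [/\ hypergraph E, hconnected E & ~ berge_cycle E].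

Definition adjmx n (E : {set {set 'I_n}}) : 'M[algC]_n :=
  \matrix_(i, j) (if i == j then 0
                  else \sum_(e in E | (i \in e) && (j \in e))
                         ((#|e|.-1)%:R)^-1).

Definition is_spectral_radius n (A : 'M[algC]_n) (r : algC) : Prop :=
  (exists a, eigenvalue A a /\ `|a| = r) /\
  (forall a, eigenvalue A a -> `|a| <= r).

Definition hiso n (E F : {set {set 'I_n}}) : Prop :=
  exists s : {perm 'I_n}, F = [set (s @: e) | e : {set 'I_n} in E].

Definition superstar n (k : nat) (E : {set {set 'I_n}}) : Prop :=
  [/\ supertree E, uniform k E & exists v, forall e, e \in E -> v \in e].

Definition double_hyperstar n (k l1 l2 : nat) (E : {set {set 'I_n}}) : Prop :=
  [/\ supertree E, uniform k E &
   exists (e : {set 'I_n}) (u1 u2 : 'I_n),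
     let A1 := [set f in E | (f != e) && (u1 \in f)] in
     let A2 := [set f in E | (f != e) && (u2 \in f)] in
     [/\ e \in E, u1 \in e, u2 \in e & u1 != u2] /\
     [/\ #|A1| = l1, #|A2| = l2,
         E = e |: (A1 :|: A2),
         (forall f g, f \in A1 -> g \in E -> g != f -> f :&: g \subset [set u1]) &
         (forall f g, f \in A2 -> g \in E -> g != f -> f :&: g \subset [set u2])]].

(* Main.v *)
Require Import Defs.
From HB Require Import structures.
From mathcomp Require Import all_boot all_order all_algebra.
From mathcomp Require Import fingroup perm algC sesquilinear spectral.
From mathcomp Require Import zify ring.
Import Order.TTheory GRing.Theory Num.Theory.
Set Implicit Arguments. Unset Strict Implicit. Unset Printing Implicit Defensive.
Local Open Scope ring_scope.
Local Open Scope sesquilinear_scope.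

(** Let [A' = (k-1) A]. In a k-uniform hypergraph [A'^2 - (k-2) A'] is a nonnegative
operator: its value at [v] is [(k-1) d_v x_v] plus the sum of [x] over the ends of
the paths [v, e, w, f, z] with [e <> f]. In a supertree such a path is determined by
[f] up to its end, so the row sum at [v] is [k-1] times the number of edges at distance
at most one from [v]. Call [v] a center if these are all [m] edges. If every
degree is at most [m-2], the vector equal to [2] on centers and [1] elsewhere shows
that [theta^2 - (k-2) theta <= (k-1)(m-1)] for [theta = (k-1) rho]: an edge near the end
[z] of a path starting at a center must contain the middle vertex [w], which
leaves room for the extra weight. The bound is attained by the superstar with [m-1]
edges, which the double hyperstar [S(n, k; m-2, 1)] properly contains; a Rayleigh quotient
makes its spectral radius strictly larger. Finally a supertree with a vertex of degree
[m] is a superstar, and one with a vertex of degree [m-1] is [S(n, k; m-2, 1)]. *)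

(** * Berge cycles from walks, and ears of acyclic families *)

Section Acyclicity.

Variables (n : nat) (E : {set {set 'I_n}}).
Implicit Types (v w x y z : 'I_n) (e f g : {set 'I_n}).

(* One step of a walk that backtracks neither on vertices nor on edges; a pair holds
   a vertex and the edge through which it is left. *)
Definition walk_step (p q : 'I_n * {set 'I_n}) : bool :=
  [&& p.2 \in E, p.1 \in p.2, q.1 \in p.2, p.1 != q.1 & p.2 != q.2].

(* A repetition at minimal distance in the walk closes up to a Berge cycle. *)
Lemma walk_repetition_cycle (p : nat -> 'I_n * {set 'I_n}) (q i : nat) :
  (forall j, walk_step (p j) (p j.+1)) -> (0 < q)%N ->
  (p i).1 = (p (i + q)%N).1 \/ (p i).2 = (p (i + q)%N).2 -> berge_cycle E.
Proof.
move=> pP; elim/ltn_ind: q i => q IHq i q_gt0 rep.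
case: (boolP [exists a : 'I_(i + q).+1, exists b : 'I_(i + q).+1,
  [&& (a < b)%N, (b - a < q)%N & ((p a).1 == (p b).1) || ((p a).2 == (p b).2)]]).
  case/existsP=> a /existsP[b /and3P[ab bq /orP ab_rep]].
  apply: (IHq (b - a)%N bq a); first by rewrite subn_gt0.
  by rewrite subnKC ?(ltnW ab)//; case: ab_rep => /eqP ->; [left | right].
move=> /existsPn norep.
have inj a b : (a <= i + q)%N -> (b <= i + q)%N -> (a < b)%N -> (b - a < q)%N ->
    (p a).1 <> (p b).1 /\ (p a).2 <> (p b).2.
  move=> ai bi ab bq; have /existsPn := norep (Ordinal (ai : (a < (i + q).+1)%N)).
  move=> /(_ (Ordinal (bi : (b < (i + q).+1)%N))) /=.
  by rewrite ab bq /= negb_or => /andP[/eqP ? /eqP ?].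
have q_gt1 : (1 < q)%N.
  rewrite ltn_neqAle q_gt0 andbT; apply/eqP => q1; move: rep; rewrite -q1 addn1.
  by have /and5P[_ _ _ /eqP ? /eqP ?] := pP i; case.
(* A repeated vertex closes the cycle on times [i, ..., i + q - 1] (shift [s = 0]). A repeated edge
   uses times [i + 1, ..., i + q] ([s = 1]): the last edge equals the one at time [i], so it
   contains the vertex at time [i + 1]. *)
have injv s a b : (s <= 1)%N -> (a < q)%N -> (b < q)%N ->
    (p (i + s + a)%N).1 = (p (i + s + b)%N).1 -> a = b.
  move=> s1 aq bq eq_ab; case: (ltngtP a b) => // ltab.
    by case: (inj (i + s + a)%N (i + s + b)%N); try lia; rewrite eq_ab.
  by case: (inj (i + s + b)%N (i + s + a)%N); try lia; rewrite eq_ab.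
have inje s a b : (s <= 1)%N -> (a < q)%N -> (b < q)%N ->
    (p (i + s + a)%N).2 = (p (i + s + b)%N).2 -> a = b.
  move=> s1 aq bq eq_ab; case: (ltngtP a b) => // ltab.
    by case: (inj (i + s + a)%N (i + s + b)%N); try lia; rewrite eq_ab.
  by case: (inj (i + s + b)%N (i + s + a)%N); try lia; rewrite eq_ab.
case: rep => rep.
- exists q, (fun t => (p (i + 0 + t)%N).1), (fun t => (p (i + 0 + t)%N).2); split => //.
  + by move=> a b; apply: injv.
  + by move=> a b; apply: inje.
  move=> t tq; have /and5P[pE pv pv' _ _] := pP (i + 0 + t)%N; split=> //.
  case: (ltnP t.+1 q) => [lt|ge]; first by rewrite modn_small// addnS.
  have eq : t.+1 = q by lia.
  have it : (i + q = (i + 0 + t).+1)%N by lia.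
  suff -> : (p (i + 0 + t.+1 %% q)%N).1 = (p (i + 0 + t).+1).1 by [].
  by rewrite -it eq modnn !addn0.
exists q, (fun t => (p (i + 1 + t)%N).1), (fun t => (p (i + 1 + t)%N).2); split => //.
- by move=> a b; apply: injv.
- by move=> a b; apply: inje.
move=> t tq; have /and5P[pE pv pv' _ _] := pP (i + 1 + t)%N; split=> //.
case: (ltnP t.+1 q) => [lt|ge]; first by rewrite modn_small// addnS.
have eq : t.+1 = q by lia.
have -> : (i + 1 + t = i + q)%N by lia.
by rewrite eq modnn addn0 addn1 -rep; have /and5P[] := pP i.
Qed.

Lemma infinite_walk_cycle (p : nat -> 'I_n * {set 'I_n}) :
  (forall j, walk_step (p j) (p j.+1)) -> berge_cycle E.
Proof.
move=> pP; pose h (i : 'I_n.+1) := (p i).1.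
have /injectivePn[a [b ab hab]] : ~~ injectiveb h.
  by apply/negP=> /injectiveP/leq_card; rewrite !card_ord ltnn.
wlog ltab : a b ab hab / (a < b)%N.
  move=> W; case: (ltngtP a b) => [||/val_inj eq_ab]; first exact: W.
    by apply: W; rewrite 1?eq_sym.
  by rewrite eq_ab eqxx in ab.
apply: (walk_repetition_cycle (q := (b - a)%N) (i := a) pP); first by rewrite subn_gt0.
by left; rewrite subnKC ?(ltnW ltab).
Qed.

(** Iterating [next] gives an infinite walk. Only consecutive vertices and edges have to differ, so
    the later arguments exhibit a short closed walk without checking full distinctness. *)
Lemma closed_walk_cycle (s : seq ('I_n * {set 'I_n})) :
  s != [::] -> path.cycle walk_step s -> berge_cycle E.
Proof.
case: s => [//|x0 s] _ cs.
apply: (infinite_walk_cycle (p := fun i => iter i (next (x0 :: s)) x0)) => j.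
rewrite iterS; apply: next_cycle => //.
by elim: j => [|j IHj]; rewrite ?mem_head// iterS mem_next.
Qed.

(** If every edge of [F] met the others in two or more vertices, a walk could always leave an edge
    by a new vertex into another edge, and would never stop. *)
Lemma exists_ear (F : {set {set 'I_n}}) :
  ~ berge_cycle E -> F \subset E -> F != set0 ->
  exists2 e, e \in F & (#|e :&: cover (F :\ e)| <= 1)%N.
Proof.
move=> acyc FE /set0Pn[e0 e0F].
case: (boolP [exists e in F, (#|e :&: cover (F :\ e)| <= 1)%N]) => [/exists_inP//|].
move=> /exists_inPn noear; case: acyc.
pose ok (p : 'I_n * {set 'I_n}) := (p.2 \in F) && (p.1 \in p.2).
have ext (p : 'I_n * {set 'I_n}) : p.2 \in F -> exists q, [&& ok q, q.1 \in p.2, p.1 != q.1 & p.2 != q.2].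
  case: p => v e /= eF; have := noear e eF; rewrite -ltnNge => /card_gt1P[x [y [xI yI xy]]].
  have [w wI wv] : exists2 w, w \in e :&: cover (F :\ e) & v != w.
    case: (eqVneq v x) => [->|vx]; [by exists y|by exists x].
  move: wI; rewrite inE => /andP[we /bigcupP[f]]; rewrite !inE => /andP[fe fF] wf.
  by exists (w, f); rewrite /ok /= fF wf we wv eq_sym fe.
pose nx (p : 'I_n * {set 'I_n}) := odflt p [pick q : 'I_n * {set 'I_n} | [&& ok q, q.1 \in p.2, p.1 != q.1 & p.2 != q.2]].
have nxP p : p.2 \in F -> [&& ok (nx p), (nx p).1 \in p.2, p.1 != (nx p).1 & p.2 != (nx p).2].
  by move=> pF; rewrite /nx; case: pickP => [q|no] //; have [q] := ext p pF; rewrite no.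
have [v0 v0e] : exists v0, v0 \in e0.
  have := noear e0 e0F; rewrite -ltnNge => /card_gt1P[x [_ [xI _ _]]].
  by exists x; case/setIP: xI.
apply: (infinite_walk_cycle (p := fun i => iter i nx (v0, e0))) => j.
have ok_j : ok (iter j nx (v0, e0)).
  elim: j => [|j IHj]; first by rewrite /ok e0F v0e.
  by rewrite iterS; case/andP: IHj => /nxP/and4P[].
case/andP: ok_j => jF je; rewrite iterS /walk_step (subsetP FE) ?je//=.
by have /and4P[_ -> -> ->] := nxP _ jF.
Qed.

(** Removing an ear uncovers at least [k.-1] vertices; the last remaining edge contributes one
    more. *)
Lemma card_cover_acyclic (k : nat) (F : {set {set 'I_n}}) :
  ~ berge_cycle E -> uniform k E -> (0 < k)%N -> F \subset E -> F != set0 ->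
  (#|F| * k.-1 < #|cover F|)%N.
Proof.
move=> acyc unif k0; elim: {F}#|F| {-2}F (erefl #|F|) => [|c IHc] F cF FE F0.
  by move: F0; rewrite -cards_eq0 cF.
have [e eF ear] := exists_ear acyc FE F0.
have ke : #|e| = k by apply: unif; apply: (subsetP FE).
have cov : cover F = e :|: cover (F :\ e) by rewrite /cover (big_setD1 e).
have cFe : #|F :\ e| = c by move: cF; rewrite (cardsD1 e F) eF => -[].
rewrite cF cov cardsU ke; case: (eqVneq (F :\ e) set0) => [Fe0|Fe0].
  have <- : 0%N = c by rewrite -cFe Fe0 cards0.
  by rewrite Fe0 /cover big_set0 setI0 !cards0; lia.
have := IHc (F :\ e) cFe (subset_trans (subsetDl _ _) FE) Fe0.
rewrite cFe; lia.
Qed.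

End Acyclicity.

(** * Connectedness and the order of a supertree *)

Lemma cover_connected n (E : {set {set 'I_n}}) :
  hconnected E -> E != set0 -> (forall e, e \in E -> 2 <= #|e|)%N -> cover E = setT.
Proof.
move=> conn /set0Pn[e eE] big; apply/setP=> x; rewrite inE; apply/bigcupP.
have [y xy] : exists y, y != x.
  have /card_gt1P[a [b [_ _ ab]]] := big e eE.
  by case: (eqVneq a x) => [<-|]; [exists b; rewrite eq_sym | exists a].
case/connectP: (conn x y) => -[|z p] /= ; first by move=> _ eq; rewrite eq eqxx in xy.
by case/andP=> /exists_inP[f fE /andP[xf _]] _ _; exists f.
Qed.

Lemma connected_leave n (E : {set {set 'I_n}}) (U : {set 'I_n}) (x y : 'I_n) :
  hconnected E -> x \in U -> y \notin U ->
  exists e, [/\ e \in E, ~~ [disjoint e & U] & ~~ (e \subset U)].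
Proof.
move=> conn xU yU; case/connectP: (conn x y) => p.
elim: p x xU => [|z p IHp] x xU /=; first by move=> _ eq; rewrite eq xU in yU.
case/andP=> /exists_inP[e eE /andP[xe ze]] pth yl.
case: (boolP (z \in U)) => zU; first exact: (IHp z).
exists e; split=> //.
  by apply/pred0Pn; exists x; rewrite /= xe.
by apply/subsetPn; exists z.
Qed.

Lemma card_cover_connected n (k : nat) (E : {set {set 'I_n}}) :
  hconnected E -> uniform k E -> (1 < k)%N -> E != set0 -> (n <= #|E| * k.-1 + 1)%N.
Proof.
move=> conn unif k1 E0.
have covE : cover E = setT by apply: cover_connected => // e /unif ->.
have [e0 e0E] := set0Pn _ E0.
(* A maximal subfamily with this bound covers everything: otherwise an edge crossing the boundary of
   its cover brings at most [k.-1] new vertices and could be added. *)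
pose P (F : {set {set 'I_n}}) :=
  [&& F \subset E, F != set0 & (#|cover F| <= #|F| * k.-1 + 1)%N].
have P0 : P [set e0].
  apply/and3P; split; rewrite ?sub1set//; first by apply/set0Pn; exists e0; rewrite inE.
  by rewrite /cover big_set1 cards1 (unif e0)//; lia.
have [F /maxsetP[/and3P[FE F0 cF] maxF] _] := maxset_exists P0.
case: (boolP (cover F == setT)) => [/eqP cT|].
  have := subset_leq_card FE; move: cF; rewrite cT cardsT card_ord; nia.
rewrite eqEsubset subsetT /= => /subsetPn[y _ yF].
have [f fF] := set0Pn _ F0; have fE := subsetP FE f fF.
have [x xf] : exists x, x \in f by apply/card_gt0P; rewrite (unif f)//; lia.
have xF : x \in cover F by apply/bigcupP; exists f.
have [e [eE ndis nsub]] := connected_leave conn xF yF.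
have eF : e \notin F by apply: contra nsub => eF; apply: bigcup_sup.
have: P (e |: F).
  apply/and3P; split; first by rewrite subUset sub1set eE.
    by apply/set0Pn; exists e; rewrite !inE eqxx.
  rewrite cardsU1 eF /cover big_setU1// -/(cover F) cardsU (unif e)//.
  have : (0 < #|e :&: cover F|)%N by rewrite card_gt0 setI_eq0.
  rewrite add1n mulSn; move: cF k1; clear; set t := (_ * _)%N.
  by move: #|_ :&: _| #|cover F| t => a b t; lia.
move=> /maxF /(_ (subsetUr _ _)) eq; by rewrite -eq !inE eqxx in eF.
Qed.

Lemma supertree_order n (k : nat) (E : {set {set 'I_n}}) :
  supertree E -> uniform k E -> (1 < k)%N -> E != set0 -> (n = #|E| * k.-1 + 1)%N.
Proof.
case=> _ conn acyc unif k1 E0.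
have := card_cover_connected conn unif k1 E0.
have := card_cover_acyclic acyc unif (ltnW k1) (subxx _) E0.
rewrite cover_connected// ?cardsT ?card_ord; last by move=> e /unif ->.
lia.
Qed.

(** * Edges at distance at most one, and centers *)

Section Neighbourhoods.

Variables (n : nat) (E : {set {set 'I_n}}).
Implicit Types (v w x y z : 'I_n) (e f g : {set 'I_n}).

Definition incident v : {set {set 'I_n}} := [set e in E | v \in e].

(** The end is omitted: a triple [(e, w, f)] stands for all paths [v, e, w, f, z] with [z] in [f]
    other than [w]. *)
Definition two_paths v : {set {set 'I_n} * 'I_n * {set 'I_n}} :=
  [set t | [&& t.1.1 \in E, v \in t.1.1, t.1.2 \in t.1.1, t.1.2 != v,
               t.2 \in E, t.1.2 \in t.2 & t.2 != t.1.1]].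

Definition near v : {set {set 'I_n}} := incident v :|: [set t.2 | t in two_paths v].

Definition center v : bool := near v == E.

Hypothesis acyc : ~ berge_cycle E.

Lemma edge_inter_le1 e f x y : e \in E -> f \in E -> e != f ->
  x \in e -> x \in f -> y \in e -> y \in f -> x = y.
Proof.
move=> eE fE ef xe xf ye yf; apply/eqP/negPn/negP => xy; case: acyc.
apply: (closed_walk_cycle (s := [:: (x, e); (y, f)])) => //=.
by rewrite /walk_step /= eE fE xe ye xy ef xf yf eq_sym xy eq_sym ef.
Qed.

Lemma two_pathsP v e w f : reflect
  [/\ [/\ e \in E, v \in e, w \in e & w != v], f \in E, w \in f & f != e]
  ((e, w, f) \in two_paths v).
Proof.
rewrite inE /=; apply: (iffP idP) => [/and5P[-> -> -> -> /and3P[-> -> ->]]//|].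
by move=> [[-> -> -> ->] -> -> ->].
Qed.

Lemma two_paths_avoid v e w f : (e, w, f) \in two_paths v -> v \notin f.
Proof.
case/two_pathsP=> [[eE ve we wv] fE wf fe]; apply/negP => vf.
by move/eqP: wv; apply; apply: (edge_inter_le1 eE fE) => //; rewrite eq_sym.
Qed.

Lemma two_paths_rev v e w f z : (e, w, f) \in two_paths v -> z \in f -> z != w ->
  (f, w, e) \in two_paths z.
Proof.
case/two_pathsP=> [[eE ve we wv] fE wf fe] zf zw.
by apply/two_pathsP; split=> //; [split=> //; rewrite eq_sym | rewrite eq_sym].
Qed.

(** Two such paths with the same last edge close up through [e], [f] and [e'], or make two edges
    share two vertices. Hence [near] can be counted by triples. *)
Lemma two_paths_inj v : {in two_paths v &, injective snd}.
Proof.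
move=> [[e w] f] [[e' w'] f'] tP tP' /= ff'; rewrite -{f'}ff' in tP' *.
have vf := two_paths_avoid tP.
case/two_pathsP: tP => [[eE ve we wv] fE wf fe].
case/two_pathsP: tP' => [[e'E ve' we' wv'] _ wf' fe'].
case: (eqVneq e e') => [ee'|ee'].
  by rewrite -ee' in we' *; rewrite (@edge_inter_le1 f e w w').
case: (eqVneq w w') => [ww'|ww'].
  rewrite -ww' in we'; case/eqP: wv.
  exact: (edge_inter_le1 eE e'E ee').
case: acyc; apply: (closed_walk_cycle (s := [:: (v, e); (w, f); (w', e')])) => //=.
rewrite /walk_step /= eE ve we (eq_sym v) wv (eq_sym e) fe fE wf wf' ww' fe' e'E we' ve'.
by rewrite wv' eq_sym ee'.
Qed.

Lemma near_sub v : near v \subset E.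
Proof.
apply/subsetP=> e /setUP[|/imsetP[[[f w] g] /two_pathsP[_ gE _ _] ->]//].
by rewrite inE => /andP[].
Qed.

Lemma card_near v : #|near v| = (#|incident v| + #|two_paths v|)%N.
Proof.
rewrite cardsU (card_in_imset (@two_paths_inj v)).
suff -> : incident v :&: [set t.2 | t in two_paths v] = set0 by rewrite cards0 subn0.
apply/setP=> g; rewrite !inE; apply/negP=> /andP[/andP[_ vg]].
by case/imsetP=> -[[e w] f] /two_paths_avoid/negP vf gf; apply: vf; rewrite -[f]gf.
Qed.

Lemma center_card v : center v -> (#|incident v| + #|two_paths v| = #|E|)%N.
Proof. by rewrite -card_near => /eqP ->. Qed.

Lemma noncenter_card v : ~~ center v -> (#|incident v| + #|two_paths v| < #|E|)%N.
Proof. by move=> nc; rewrite -card_near proper_card// properEneq nc near_sub. Qed.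

(** An edge [g] at [z] other than [f] would still lie in [near v], hence lead back to [v] through at
    most one further edge and close a cycle. *)
Lemma center_leaf v e w f z g : center v -> (e, w, f) \in two_paths v ->
  z \in f -> z != w -> g \in E -> z \in g -> g = f.
Proof.
move=> /eqP cv tP zf zw gE zg; have vf := two_paths_avoid tP.
case/two_pathsP: tP => [[eE ve we wv] fE wf fe].
have ze : z \notin e.
  apply: contra zw => ze; apply/eqP; exact: (edge_inter_le1 fE eE fe).
have vz : v != z by apply: contraNneq vf => ->.
apply/eqP/negPn/negP => gf; case: acyc.
have /setUP[] : g \in near v by rewrite cv.
  rewrite inE => /andP[_ vg].
  apply: (closed_walk_cycle (s := [:: (v, e); (w, f); (z, g)])) => //=.
  rewrite /walk_step /= eE ve we (eq_sym v) wv (eq_sym e) fe fE wf zf (eq_sym w) zw.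
  rewrite (eq_sym f) gf gE zg vg eq_sym vz /= andbT.
  by apply: contraNneq ze => <-.
case/imsetP=> -[[e' x] g'] tP' /= gg'; rewrite -gg' in tP'; have vg := two_paths_avoid tP'.
case/two_pathsP: tP' => [[e'E ve' xe' xv] _ xg ge'].
(* Each of the coincidences [e' = e] and [z = x] shortens the closed walk to three edges; without
   them it has four, and [x = w] is then harmless. *)
case: (eqVneq e' e) => [ee'|ee'].
  rewrite ee' in xe' ge'; case: (eqVneq x w) => [xw|xw].
    rewrite xw in xg; case/eqP: zw.
    by apply: (edge_inter_le1 gE fE gf).
  apply: (closed_walk_cycle (s := [:: (w, f); (z, g); (x, e)])) => //=.
  rewrite /walk_step /= fE wf zf (eq_sym w) zw (eq_sym f) gf gE zg xg ge' eE xe' we xw.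
  rewrite (eq_sym e) fe /= !andbT.
  by apply: contraNneq ze => ->.
case: (eqVneq z x) => [zx|zx].
  rewrite -zx in xe'.
  apply: (closed_walk_cycle (s := [:: (v, e); (w, f); (z, e')])) => //=.
  rewrite /walk_step /= eE ve we (eq_sym v) wv (eq_sym e) fe fE wf zf (eq_sym w) zw.
  rewrite e'E xe' ve' ee' (eq_sym z) vz /= !andbT.
  by apply: contraNneq vf => ->.
apply: (closed_walk_cycle (s := [:: (v, e); (w, f); (z, g); (x, e')])) => //=.
rewrite /walk_step /= eE ve we (eq_sym v) wv (eq_sym e) fe fE wf zf (eq_sym w) zw.
by rewrite (eq_sym f) gf gE zg xg zx ge' e'E xe' ve' xv ee'.
Qed.

(** By [center_leaf] the vertices of [f] other than [w] have degree one, so an edge near [z] is [f]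
    itself or is reached through [w]. *)
Lemma center_near v e w f z : center v -> (e, w, f) \in two_paths v ->
  z \in f -> z != w -> near z \subset incident w.
Proof.
move=> cv tP zf zw; have leaf := center_leaf cv tP.
case/two_pathsP: (tP) => [_ fE wf fe].
apply/subsetP=> g; rewrite inE => /orP[|].
  by rewrite !inE => /andP[gE zg]; rewrite gE (leaf z g).
case/imsetP=> -[[f' x] g'] /two_pathsP[[f'E zf' xf' xz] gE xg gf'] -> /=.
have ff' := leaf z f' zf zw f'E zf'.
rewrite inE gE /=; case: (eqVneq x w) => [<-//|xw].
by move/eqP: gf'; case; rewrite ff'; apply: (leaf x) => //; rewrite -ff'.
Qed.

End Neighbourhoods.

(** * The weighted row sums *)

Section EdgeWeights.

Variables (n k : nat) (E : {set {set 'I_n}}).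
Hypotheses (acyc : ~ berge_cycle E) (unif : uniform k E).
Hypothesis deg_le : forall v, (#|incident E v| + 2 <= #|E|)%N.

Definition cweight (v : 'I_n) : nat := (1 + center E v)%N.

Lemma sum_cweight (v : 'I_n) t : t \in two_paths E v ->
  (\sum_(z in t.2 | z != t.1.2) cweight z =
   k.-1 + #|[set z in t.2 | (z != t.1.2) && center E z]|)%N.
Proof.
case: t => [[e w] f] /two_pathsP[_ fE wf _] /=.
rewrite big_split /= sum1_card -(unif fE) (cardD1 w f) wf /=; congr (_ + _)%N.
  by apply: eq_card => z; rewrite !inE andbC.
rewrite -sum1_card big_mkcond [RHS]big_mkcond /=; apply: eq_bigr => z _; rewrite !inE.
by case: (z \in f) => //=; case: (z != w) => //=; case: center.
Qed.

(** Beyond [k.-1] per path, the excess comes from centers at the ends of paths; either it vanishes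
    or [deg_le] leaves room for it. *)
Lemma cweight_bound (v : 'I_n) :
  (k.-1 * #|incident E v| * cweight v +
     \sum_(t in two_paths E v) \sum_(z in t.2 | z != t.1.2) cweight z
   <= k.-1 * #|E|.-1 * cweight v)%N.
Proof.
under eq_bigr => t tP do rewrite (sum_cweight tP).
rewrite big_split /= sum_nat_const.
(* Otherwise all [#|E|] edges would lie in a star of at most [#|E| - 2]. *)
have noncenter w z : near E z \subset incident E w -> ~~ center E z.
  move=> /subset_leq_card le; apply/negP=> /eqP eqE.
  by have := deg_le w; rewrite eqE in le; lia.
case: (boolP (center E v)) => cv.
  rewrite big1 => [|[[e w] f] tP]; last first.
    apply: eq_card0 => z; rewrite !inE /=; apply/negP=> /and3P[zf zw].
    by apply/negP; apply: (noncenter w); apply: (center_near acyc cv tP).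
  (* With [d] incident edges, [p] paths and [m = d + p], the goal is [2 * d + p <= 2 * m.-1] up to
     the factor [k.-1]; this is [d + 2 <= m]. *)
  rewrite /cweight cv /=; have := center_card acyc cv; have := deg_le v.
  by move: #|incident _ _| #|two_paths _ _| #|E| k.-1 => d p m r; nia.
rewrite /cweight (negbTE cv) addn0 !muln1.
have lt_near := noncenter_card acyc cv.
case: (boolP [exists t in two_paths E v,
    [exists z in t.2, (z != t.1.2) && center E z]]) => [|/exists_inPn no]; last first.
  rewrite big1 => [|t tP]; last first.
    apply: eq_card0 => z; rewrite !inE /=.
    by have /existsPn/(_ z)/negbTE := no t tP.
  by move: #|incident _ _| #|two_paths _ _| #|E| k.-1 lt_near => d p m r; nia.
case/exists_inP=> -[[e w] f] tP /exists_inP[z zf /andP[/= zw cz]].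
have tP' := two_paths_rev tP zf zw.
case/two_pathsP: (tP) => [[eE ve we wv] fE wf fe].
(* Seen from the center [z], the path ends at [v], so all edges near [v] contain [w] and number at
   most [#|E| - 2]. The spare [k.-1] absorbs the centers in [f]. *)
have sub : near E v \subset incident E w by apply: (center_near acyc cz tP') => //; rewrite eq_sym.
have le := subset_leq_card sub; rewrite card_near// in le.
rewrite (bigD1 (e, w, f)) //= [X in (_ + (_ + (_ + X)))%N]big1 ?addn0 => [|[[e' w'] f'] /andP[t2P neq]].
  have : (#|[set z in f | (z != w) && center E z]| <= k.-1)%N.
    rewrite -(unif fE) (cardD1 w f) wf /=; apply: subset_leq_card.
    by apply/subsetP => x; rewrite !inE => /and3P[-> -> _].
  move=> few; have bound : (#|incident E v| + #|two_paths E v| + 1 <= #|E|.-1)%N.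
    by move: le (deg_le w); clear; lia.
  apply: leq_trans (leq_mul (leqnn k.-1) bound); rewrite !mulnDr muln1 -addnA.
  by rewrite [(_ * k.-1)%N]mulnC !leq_add2l.
apply: eq_card0 => z'; rewrite !inE /=; apply/negP=> /and3P[zf' zw' cz'].
(* A second path with a center at its end forces [w' = w], because [e] and [f] meet only once. Then
   [z'] ends a path from the center [z], so its near edges lie in the star of [w]. *)
have t2P' := two_paths_rev t2P zf' zw'.
case/two_pathsP: (t2P) => [[e'E ve' we' wv'] f'E wf' fe'].
have sub' : near E v \subset incident E w'.
  by apply: (center_near acyc cz' t2P') => //; rewrite eq_sym.
have inn g x : g \in near E v -> near E v \subset incident E x -> x \in g.
  by move=> gn /subsetP/(_ g gn); rewrite inE => /andP[].
have en : e \in near E v by rewrite !inE eE ve.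
have fn : f \in near E v by rewrite inE; apply/orP; right; apply/imsetP; exists (e, w, f).
have ww' : w' = w.
  apply: (edge_inter_le1 acyc fE eE fe); rewrite ?(inn _ _ en sub') ?(inn _ _ fn sub')//.
have ff' : f' != f.
  apply: contraNneq neq => ff'; apply/eqP; exact: (two_paths_inj acyc t2P tP ff').
suff : ~~ center E z' by rewrite cz'.
apply: (noncenter w); apply: (@center_near _ _ acyc z f w f') => //.
  by apply/two_pathsP; rewrite -ww'; split=> //; split; rewrite ?ww'// eq_sym.
by rewrite -ww'.
Qed.

End EdgeWeights.

(** * Spectral radius and Rayleigh quotients *)

Lemma spectral_radius_exists n (A : 'M[algC]_n) :
  (0 < n)%N -> exists r, is_spectral_radius A r.
Proof.
move=> n0; have [a0 a0P] := eigenvalue_closed A n0.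
have [rs Ers] := closed_field_poly_normal (char_poly A).
have eigE a : eigenvalue A a = (a \in rs).
  rewrite eigenvalue_root_char Ers (monicP (char_poly_monic A)) scale1r.
  by rewrite root_prod_XsubC.
(* The order of [algC] is partial, but moduli are real and hence comparable. *)
have mx (s : seq algC) : s != [::] -> exists2 a, a \in s & forall b, b \in s -> `|b| <= `|a|.
  elim: s => // a s IHs _; case: (eqVneq s [::]) => [->|/IHs[c cs cmax]].
    by exists a; rewrite ?mem_head// => b; rewrite inE => /eqP ->.
  case: (real_leP (normr_real a) (normr_real c)) => [ac|/ltW ca].
    by exists c; rewrite ?inE ?cs ?orbT// => b; rewrite inE => /orP[/eqP ->|/cmax].
  exists a; rewrite ?mem_head// => b; rewrite inE => /orP[/eqP ->//|/cmax bc].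
  exact: le_trans bc ca.
have [|a ars amax] := mx rs; first by move: a0P; rewrite eigE; case: (rs).
exists `|a|; split; first by exists a; rewrite eigE.
by move=> b; rewrite eigE => /amax.
Qed.

(** In an orthonormal eigenbasis the form is a sum of terms [d_i |z_i|^2] with real eigenvalues
    [d_i <= |d_i| <= r]. *)
Lemma rayleigh_le n (A : 'M[algC]_n) (r : algC) (x : 'rV[algC]_n) :
  A \is hermsymmx -> (forall a, eigenvalue A a -> `|a| <= r) ->
  (x *m A *m x ^t*) 0 0 <= r * (x *m x ^t*) 0 0.
Proof.
move=> Aherm rmax; have Anorm := hermitian_normalmx Aherm.
have /orthomx_spectralP Aeq := Anorm; set P := spectralmx A in Aeq; set d := spectral_diag A in Aeq.
have Pu : P \is unitarymx := spectral_unitarymx A.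
have dreal : d \is a realmx := hermitian_spectral_diag_real Aherm.
have Punit : P \in unitmx := unitarymx_unit Pu.
have Pstar : invmx P = P ^t* := invmx_unitary Pu.
have deig i : eigenvalue A (d 0 i).
  apply/eigenvalueP; exists (row i P).
    rewrite -row_mul {1}Aeq !mulmxA mulmxV// mul1mx row_mul row_diag_mx -scalemxAl.
    by rewrite -rowE.
  rewrite rowE; apply/negP=> /eqP/(congr1 (mulmx^~ (invmx P))).
  rewrite mulmxK// mul0mx => /matrixP/(_ 0 i)/eqP.
  by rewrite !mxE !eqxx oner_eq0.
pose z := x *m P ^t*.
have zE : z ^t* = P *m x ^t* by rewrite /z trmx_mul map_mxM map_trmx trmxK -map_mx_comp (map_mx_id (@conjCK _)).
have -> : x *m x ^t* = z *m z ^t* by rewrite zE mulmxA -(mulmxA x) -Pstar mulVmx ?mulmx1.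
have -> : x *m A *m x ^t* = z *m diag_mx d *m z ^t* by rewrite zE Aeq Pstar !mulmxA.
rewrite !mxE mulr_sumr; apply: ler_sum => i _.
rewrite mul_mx_diag !mxE mulrAC mulrC ler_wpM2r ?mul_conjC_ge0//.
apply: le_trans (rmax _ (deig i)); apply: real_ler_norm.
by move/mxOverP: dreal; apply.
Qed.

(** * The adjacency operator and its square *)

Section AdjacencyOperator.

Variables (n k : nat) (E : {set {set 'I_n}}).
Hypothesis unif : uniform k.+2 E.

(** For edges of size [k.+2], this is [k.+1] times the adjacency operator, free of denominators. *)
Definition adjop (R : nmodType) (x : 'I_n -> R) (v : 'I_n) : R :=
  \sum_(e in E | v \in e) \sum_(w in e | w != v) x w.

(** Two-step walks that stay in one edge give the first two terms; those that change edge are the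
    [two_paths]. *)
Lemma adjop_square (R : comNzRingType) (x : 'I_n -> R) (v : 'I_n) :
  adjop (adjop x) v = k%:R * adjop x v
    + (k.+1 * #|incident E v|)%:R * x v
    + \sum_(t in two_paths E v) \sum_(z in t.2 | z != t.1.2) x z.
Proof.
have inner (e : {set 'I_n}) (w : 'I_n) : w \in e ->
    \sum_(z in e | z != w) x z = \sum_(z in e) x z - x w.
  by move=> we; rewrite (bigD1 w we) /= addrC addrK.
(* With [s] the sum over [e], this is [k.+1 * s - (s - x v) = k * (s - x v) + k.+1 * x v]. *)
have within (e : {set 'I_n}) : (e \in E) && (v \in e) ->
    \sum_(w in e | w != v) \sum_(z in e | z != w) x z
    = k%:R * (\sum_(w in e | w != v) x w) + k.+1%:R * x v.
  case/andP=> eE ve; set s := \sum_(z in e) x z.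
  rewrite (eq_bigr (fun w => s - x w)) => [|w /andP[we _]]; last exact: inner.
  rewrite sumrB inner// -/s.
  have -> : \sum_(w in e | w != v) s = s *+ k.+1.
    rewrite sumr_const; congr (_ *+ _); have := unif eE; rewrite (cardD1 v e) ve => -[<-].
    by apply: eq_card => z; rewrite !inE andbC.
  by rewrite -mulr_natr -natr1; ring.
have split_e : adjop (adjop x) v =
  \sum_(e in E | v \in e) (k%:R * (\sum_(w in e | w != v) x w) + k.+1%:R * x v) +
  \sum_(e in E | v \in e) \sum_(w in e | w != v)
     \sum_(f in E | (w \in f) && (f != e)) \sum_(z in f | z != w) x z.
  rewrite -big_split /=; apply: eq_bigr => e eP; rewrite -within// -big_split /=.
  apply: eq_bigr => w /andP[we wv]; rewrite /adjop (bigD1 e) ?we ?andbT//=; last by case/andP: eP.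
  by congr (_ + _); apply: eq_bigl => f; rewrite andbA.
rewrite split_e big_split /= -mulr_sumr; congr (_ + _ + _).
  rewrite sumr_const -[LHS]mulr_natr natrM mulrAC; congr (_ * _%:R * _).
  by apply: eq_card => e; rewrite !inE.
rewrite pair_big_dep /= pair_big_dep /=; apply: eq_bigl => -[[e w] f].
by rewrite inE /= -!andbA.
Qed.

Lemma adjmxE (u : 'rV[algC]_n) (v : 'I_n) :
  (u *m adjmx E) 0 v * k.+1%:R = adjop (fun i => u 0 i) v.
Proof.
rewrite mxE mulr_suml /adjop.
under [RHS]eq_bigr do rewrite big_mkcond /=.
rewrite exchange_big /=; apply: eq_bigr => w _; rewrite mxE.
case: (eqVneq w v) => [->|wv].
  by rewrite mulr0 mul0r big1 // => e _; rewrite andbF.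
rewrite -mulrA mulr_suml mulr_sumr big_mkcond [RHS]big_mkcond /=; apply: eq_bigr => e _.
case: (boolP (e \in E)) => //= eE; rewrite andbT (unif eE) /= mulVf ?pnatr_eq0// mulr1.
by rewrite andbC; case: (v \in e) => //=; rewrite if_same.
Qed.

Lemma adjmx_hermsym : adjmx E \is hermsymmx.
Proof.
apply: realsym_hermsym.
  apply/is_hermitianmxP; rewrite expr0 scale1r; apply/matrixP=> i j; rewrite !mxE eq_sym.
  by case: eqP => // _; apply: eq_bigl => e; rewrite (andbC (i \in e)).
apply/mxOverP=> i j; rewrite mxE; case: eqP => // _.
by apply: rpred_sum => e _; rewrite rpredV realn.
Qed.

End AdjacencyOperator.

(* The polynomial identity of [adjop_square] turns an eigenvalue [a] into the
   eigenvalue [b ^+ 2 - k * b], [b := k.+1 * a], of a nonnegative operator, which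
   is bounded by any ratio [c] attained uniformly on a positive vector [y]. *)
Lemma eigenvalue_weight_bound n k (E : {set {set 'I_n}}) (y : 'I_n -> nat) (c : nat) (a : algC) :
  uniform k.+2 E -> (forall v, 0 < y v)%N ->
  (forall v, k.+1 * #|incident E v| * y v +
     \sum_(t in two_paths E v) \sum_(z in t.2 | z != t.1.2) y z <= c * y v)%N ->
  eigenvalue (adjmx E) a ->
  (k.+1%:R * `|a|) ^+ 2 - k%:R * (k.+1%:R * `|a|) <= c%:R.
Proof.
move=> unif y0 bound /eigenvalueP[u uA u0].
pose x i := u 0 i; pose b := k.+1%:R * a.
have Lx v : adjop E x v = b * x v.
  by rewrite -(adjmxE unif) uA mxE /b /x; ring.
have Nx v : (b ^+ 2 - k%:R * b) * x v = (k.+1 * #|incident E v|)%:R * x v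
    + \sum_(t in two_paths E v) \sum_(z in t.2 | z != t.1.2) x z.
  have := adjop_square unif x v.
  have -> : adjop E (adjop E x) v = b * adjop E x v.
    rewrite /adjop mulr_sumr; apply: eq_bigr => e _; rewrite mulr_sumr.
    by apply: eq_bigr => w _; rewrite -/(adjop E x w) Lx.
  rewrite Lx -addrA => eq; rewrite mulrBl expr2 -[b * b * _]mulrA eq; ring.
have [i0 xi0] : exists i, x i != 0.
  apply/existsP; apply: contraNT u0 => /existsPn no; apply/eqP/rowP=> i.
  by rewrite mxE; have := no i; rewrite negbK => /eqP.
have yR v : 0 < (y v)%:R :> algC by rewrite ltr0n.
(* At a vertex [v] maximising [q], [|x i| <= q v * y i] holds for all [i], with equality at [v]. *)
pose q i := `|x i| / (y i)%:R.
have qreal i : q i \is Num.real by rewrite ger0_real// divr_ge0// ltW.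
have [v vmax] : exists v, forall i, q i <= q v.
  have mx (s : seq 'I_n) : s != [::] -> exists v, forall i, i \in s -> q i <= q v.
    elim: s => // i s IHs _; case: (eqVneq s [::]) => [->|/IHs[j jmax]].
      by exists i => j; rewrite inE => /eqP ->.
    case: (real_leP (qreal i) (qreal j)) => [ij|/ltW ji].
      by exists j => l; rewrite inE => /orP[/eqP ->|/jmax].
    by exists i => l; rewrite inE => /orP[/eqP ->//|/jmax lj]; apply: le_trans lj ji.
  have [|v vmax] := mx (enum 'I_n); last by exists v => i; apply: vmax; rewrite mem_enum.
  by apply/negP=> /eqP en; have := mem_enum 'I_n i0; rewrite en.
have xle i : `|x i| <= q v * (y i)%:R by have := vmax i; rewrite {1}/q ler_pdivrMr.
have qv0 : 0 < q v.
  by apply: lt_le_trans (vmax i0); rewrite divr_gt0// normr_gt0.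
have main : `|b ^+ 2 - k%:R * b| * `|x v| <= q v * (c * y v)%:R.
  rewrite -normrM Nx; apply: le_trans (_ : q v * (k.+1 * #|incident E v| * y v +
     \sum_(t in two_paths E v) \sum_(z in t.2 | z != t.1.2) y z)%N%:R <= _); last first.
    by rewrite ler_pM2l// ler_nat.
  rewrite natrD mulrDr natr_sum; apply: le_trans (ler_normD _ _) (lerD _ _).
    by rewrite normrM normr_nat [(_ * y v)%:R]natrM mulrCA ler_wpM2l.
  rewrite mulr_sumr; apply: le_trans (ler_norm_sum _ _ _) (ler_sum _ _) => t _.
  rewrite natr_sum mulr_sumr; apply: le_trans (ler_norm_sum _ _ _) (ler_sum _ _) => z _.
  exact: xle.
have xv : `|x v| = q v * (y v)%:R by rewrite divfK// gt_eqF.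
have qy0 : 0 < q v * (y v)%:R := mulr_gt0 qv0 (yR v).
move: main; rewrite xv natrM [X in _ <= X]mulrCA ler_pM2r//.
(* Reverse triangle inequality: [|b|^2 - k |b| <= |b^2 - k b|]. *)
apply: le_trans; apply: le_trans (lerB_normD _ _); rewrite normrN.
by rewrite normrX !normrM !normr_nat.
Qed.

(** * Near-stars and a lower bound for their radius *)

(** In a uniform supertree this is a double hyperstar with a single edge [f] attached at [u],
    described without edge counts. *)
Definition near_star n (E : {set {set 'I_n}}) (c u : 'I_n) (e0 f : {set 'I_n}) : Prop :=
  [/\ (e0, u, f) \in two_paths E c & forall e, e \in E -> e != f -> c \in e].

Lemma near_star_degree n (E : {set {set 'I_n}}) c u e0 f :
  ~ berge_cycle E -> near_star E c u e0 f -> #|incident E c| = #|E|.-1.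
Proof.
move=> acyc [tP others]; have cf := two_paths_avoid acyc tP.
case/two_pathsP: tP => [_ fE _ _].
suff -> : incident E c = E :\ f by rewrite (cardsD1 f E) fE.
apply/setP=> e; rewrite !inE; case: (eqVneq e f) => [->|ef] /=; first by rewrite (negbTE cf) andbF.
by case: (boolP (e \in E)) => //= /others ->.
Qed.

(** [th] belongs to the superstar formed by the edges through [c]. Its positive eigenvector extends
    to [f] with [th * x <= adjop E x], strictly at [u], so the Rayleigh quotient exceeds [th]. *)
Lemma near_star_radius_gt n k (E : {set {set 'I_n}}) c u e0 f (r th : algC) :
  ~ berge_cycle E -> uniform k.+2 E -> cover E = setT -> near_star E c u e0 f ->
  is_spectral_radius (adjmx E) r ->
  0 < th -> th ^+ 2 - k%:R * th = (k.+1 * #|E|.-1)%:R -> th < k.+1%:R * r.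
Proof.
move=> acyc unif cov ns [[a [_ ra]] rmax] th0 thE.
have dc := near_star_degree acyc ns.
case: ns => tP others; have cf := two_paths_avoid acyc tP.
case/two_pathsP: tP => [[e0E ce0 ue0 uc] fE uf fe0].
have rreal : r \is Num.real by rewrite -ra normr_real.
have kr : k.+1%:R * r \is Num.real by rewrite realM ?realn.
have thr := gtr0_real th0; rewrite real_ltNge//; apply/negP => rle.
have thk : 0 < th - k%:R.
  rewrite -(pmulr_rgt0 _ th0) mulrBr -expr2 [th * _]mulrC thE ltr0n muln_gt0 /=.
  by rewrite -dc card_gt0; apply/set0Pn; exists e0; rewrite inE e0E.
pose near_c v := [exists e in incident E c, v \in e].
have near_cI e w : e \in E -> c \in e -> w \in e -> near_c w.
  by move=> eE ce we; rewrite /near_c; apply/exists_inP; exists e; rewrite ?inE ?eE.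
(* A vertex other than [c] sees [(th - k) + k = th] within an edge through [c]. The value [th^-1] on
   the rest of [f] makes [th * x = 1 = x u] there. *)
pose x v : algC := if v == c then th - k%:R else if near_c v then 1 else th^-1.
have x0 v : 0 < x v by rewrite /x; case: ifP => // _; case: ifP; rewrite ?invr_gt0.
have x1 e w : e \in E -> c \in e -> w \in e -> w != c -> x w = 1.
  move=> eE ce we wc; by rewrite /x (negbTE wc) (near_cI e).
have sum0 (P : pred 'I_n) : 0 <= \sum_(w | P w) x w by apply: sumr_ge0 => w _; apply: ltW.
have Lge e v : e \in E -> v \in e -> \sum_(w in e | w != v) x w <= adjop E x v.
  by move=> eE ve; rewrite /adjop (bigD1 e) ?eE //= lerDl sumr_ge0.
have star_sum e v : e \in E -> c \in e -> v \in e -> v != c ->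
    \sum_(w in e | w != v) x w = th.
  move=> eE ce ve vc; rewrite (bigD1 c) ?ce 1?eq_sym//= {1}/x eqxx.
  rewrite (eq_bigr (fun=> 1)) => [|w /andP[/andP[we _] wc]]; last exact: (x1 e).
  rewrite sumr_const.
  have -> : #|(fun w => (w \in e) && (w != v) && (w != c))| = k.
    have := unif e eE; rewrite (cardD1 c e) ce (cardD1 v) !inE vc ve => -[<-].
    apply: eq_card => w; rewrite !inE [LHS]unfold_in.
    by case: (w \in e); case: (w == v); case: (w == c).
  by rewrite subrK.
have Lx v : th * x v <= adjop E x v.
  case: (eqVneq v c) => [->|vc].
    rewrite {1}/x eqxx mulrBr -expr2 [th * _]mulrC thE -dc natrM /adjop.
    rewrite (eq_bigr (fun=> k.+1%:R)) => [|e /andP[eE ce]].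
      rewrite sumr_const -[X in _ <= X]mulr_natr.
      by rewrite (@eq_card _ (fun e => (e \in E) && (c \in e)) (mem (incident E c))) // => e; rewrite !inE.
    rewrite (eq_bigr (fun=> 1)) => [|w /andP[we wc]]; last exact: (x1 e).
    rewrite sumr_const; congr _%:R; have := unif e eE; rewrite (cardD1 c e) ce => -[<-].
    by apply: eq_card => w; rewrite !inE andbC.
  case: (boolP (near_c v)) => [nv|nv].
    case/exists_inP: (nv) => e; rewrite inE => /andP[eE ce] ve.
    by rewrite {1}/x (negbTE vc) nv mulr1 -(star_sum e v)// Lge.
  rewrite {1}/x (negbTE vc) (negbTE nv) mulfV ?gt_eqF//.
  have vf : v \in f.
    have : v \in cover E by rewrite cov inE.
    case/bigcupP=> e eE ve; case: (eqVneq e f) => [<-//|ef]; case/negP: nv.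
    exact: near_cI eE (others e eE ef) ve.
  have uv : u != v by apply: contraNneq nv => <-; apply: near_cI ue0.
  apply: le_trans (Lge f v fE vf); rewrite (bigD1 u) ?uf//= (x1 e0 u)// lerDl; exact: sum0.
have Lu : th * x u < adjop E x u.
  rewrite (x1 e0 u)// mulr1 /adjop (bigD1 e0) ?e0E//= star_sum// ltrDl.
  rewrite (bigD1 f) ?fE ?uf//= ltr_wpDr ?sumr_ge0//.
  have [z zf zu] : exists2 z, z \in f & z != u.
    have /card_gt1P[z1 [z2 [z1f z2f z12]]] : (1 < #|f|)%N by rewrite unif.
    by case: (eqVneq z1 u) => [<-|]; [exists z2; rewrite // eq_sym | exists z1].
  by rewrite (bigD1 z) ?zf//= ltr_wpDr.
pose X := \row_v x v.
have Xstar : X ^t* = X^T.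
  by apply/matrixP=> i j; rewrite !mxE conj_Creal// gtr0_real.
have := rayleigh_le X (adjmx_hermsym E) rmax; rewrite Xstar => ray.
have := ler_wpM2l (ler0n _ k.+1) ray; rewrite mulrA.
have -> : k.+1%:R * (X *m adjmx E *m X^T) 0 0 = \sum_v x v * adjop E x v.
  rewrite mxE mulr_sumr; apply: eq_bigr => v _; rewrite mulrA [k.+1%:R * _]mulrC (adjmxE unif).
  rewrite !mxE mulrC; congr (_ * _); apply: eq_bigr => e _; apply: eq_bigr => w _.
  by rewrite mxE.
have -> : (X *m X^T) 0 0 = \sum_v x v * x v.
  by rewrite mxE; apply: eq_bigr => v _; rewrite !mxE.
move=> le; suff /(le_lt_trans le) : k.+1%:R * r * (\sum_v x v * x v) < \sum_v x v * adjop E x v.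
  by rewrite ltxx.
apply: le_lt_trans (_ : th * \sum_v x v * x v < _).
  by apply: ler_wpM2r => //; apply: sumr_ge0 => v _; rewrite mulr_ge0 ?ltW.
rewrite mulr_sumr (bigD1 u)//= [X in _ < X](bigD1 u)//=; apply: ltr_leD.
  by rewrite mulrCA ltr_pM2l.
by apply: ler_sum => v _; rewrite mulrCA ler_pM2l.
Qed.

(** * Near-stars of equal size are isomorphic *)

(* Colours of the vertices of a near-star: 0 the center [c], 1 the vertex [u], 2 the rest
   of [e0], 3 the rest of [f], and [j + 4] the rest of the [j]-th other edge through [c].
   Edges are unions of colour classes, so matching class sizes yield an isomorphism. *)
Definition color_count (m k j : nat) : nat :=
  match j with
  | 0 | 1 => 1
  | 2 => k.-2
  | 3 => k.-1
  | j'.+4 => if (j' < m.-2)%N then k.-1 else 0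
  end.

(** Edge [0] is [e0], edge [1] is [f], and edge [j.+2] is the [j]-th other edge through [c]. *)
Definition edge_pattern (j : nat) : pred nat :=
  match j with
  | 0 => [pred i | (i < 3)%N]
  | 1 => pred2 1%N 3
  | j'.+2 => pred2 0%N j'.+4
  end.

(** Edges through [c] meet pairwise only in [c], and [f] meets them only in [u], on [e0]. So the
    class sizes depend only on [#|E|] and [k]. *)
Lemma near_star_coloring n k (E : {set {set 'I_n}}) c u e0 f :
  ~ berge_cycle E -> uniform k E -> cover E = setT -> near_star E c u e0 f ->
  exists col : 'I_n -> nat,
    (forall j, #|[set x | col x == j]| = color_count #|E| k j) /\
    (forall e, e \in E <->
       exists2 j, (j < #|E|)%N & e = [set x | edge_pattern j (col x)]).
Proof.
move=> acyc unif cov ns; have dc := near_star_degree acyc ns.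
case: ns => tP others; have cf := two_paths_avoid acyc tP.
case/two_pathsP: (tP) => [[e0E ce0 ue0 uc] fE uf fe0].
pose R := incident E c :\ e0; pose s := enum R.
have R_E e : e \in R -> [/\ e \in E, c \in e & e != e0].
  by rewrite !inE => /and3P[-> -> ->].
have size_s : size s = #|E|.-2.
  by rewrite -cardE; move: dc; rewrite (cardsD1 e0 (incident E c)) inE e0E ce0 => <-.
have m2 : (#|E| = (size s).+2)%N.
  by rewrite size_s; move: dc; rewrite (cardsD1 e0 (incident E c)) inE e0E ce0; clear; case: #|E| => [|[|m]].
have sR j : (j < size s)%N -> nth set0 s j \in R by move=> js; rewrite -mem_enum mem_nth.
have e0f x : x \in e0 -> x \in f -> x = u.
  by move=> xe xf; apply: (edge_inter_le1 acyc fE e0E fe0).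
(* Such an edge would give a second path from [c] with last edge [f]. *)
have Rf e x : e \in R -> x \in e -> x \in f -> False.
  move=> /R_E[eE ce ee0] xe xf.
  have tP' : (e, x, f) \in two_paths E c.
    apply/two_pathsP; split=> //.
      by split=> //; apply: contraNneq cf => <-.
    by apply: contraNneq cf => ->.
  by case: (two_paths_inj acyc tP' tP erefl) => /eqP; rewrite (negbTE ee0).
have Re0 e x : e \in R -> x \in e -> x \in e0 -> x = c.
  by move=> /R_E[eE ce ee0] xe xe0; apply: (edge_inter_le1 acyc eE e0E ee0).
have RR e e' x : e \in R -> e' \in R -> x \in e -> x \in e' -> x != c -> e = e'.
  move=> /R_E[eE ce _] /R_E[e'E ce' _] xe xe' xc; apply/eqP/negPn/negP => ee'.
  by case/eqP: xc; apply: (edge_inter_le1 acyc eE e'E ee').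
pose col x := if x == c then 0%N else if x == u then 1%N else if x \in f then 3%N
  else if x \in e0 then 2%N else (find (fun e : {set 'I_n} => x \in e) s).+4.
have colc x : (col x == 0%N) = (x == c) by rewrite /col; do 4!case: ifP => //.
have colu x : (col x == 1%N) = (x == u).
  rewrite /col; case: (eqVneq x c) => [->|_]; first by rewrite [c == u]eq_sym (negbTE uc).
  by do 3!case: ifP => //.
have col2 x : (col x == 2%N) = [&& x \in e0, x != c & x != u].
  rewrite /col; case: (eqVneq x c) => [_|_]; rewrite ?andbF//.
  case: (eqVneq x u) => [_|xu]; rewrite ?andbF//= andbT.
  case: (boolP (x \in f)) => [xf|_]; last by case: ifP.
  by apply/esym/negP => xe; case/eqP: xu; apply: e0f.
have col3 x : (col x == 3%N) = (x \in f) && (x != u).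
  rewrite /col; case: (eqVneq x c) => [->|_]; first by rewrite (negbTE cf).
  case: (eqVneq x u) => [_|xu]; rewrite ?andbF//= andbT.
  by case: (x \in f) => //; case: ifP.
have col4 x j : (j < size s)%N -> (col x == j.+4) = (x \in nth set0 s j) && (x != c).
  move=> js; have jR := sR j js.
  rewrite /col; case: (eqVneq x c) => [_|xc]; rewrite ?andbF//= andbT.
  case: (eqVneq x u) => [->|xu]; first by apply/esym/negP => /(Rf _ _ jR); apply.
  case: (boolP (x \in f)) => [xf|xf]; first by apply/esym/negP => /(Rf _ _ jR); apply.
  case: (boolP (x \in e0)) => [xe|xe].
    by apply/esym/negP => /(Re0 _ _ jR)/(_ xe)/eqP; rewrite (negbTE xc).
  rewrite !eqSS; apply/eqP/idP => [fj|xj].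
    by rewrite -fj; apply: (nth_find set0 (a := fun e : {set 'I_n} => x \in e)); rewrite has_find fj.
  have hs : has (fun e : {set 'I_n} => x \in e) s.
    by apply/hasP; exists (nth set0 s j); rewrite ?mem_nth.
  have xi := nth_find set0 hs; rewrite has_find in hs.
  apply/eqP; rewrite -(nth_uniq set0 hs js (enum_uniq _)); apply/eqP.
  exact: RR (sR _ hs) jR xi xj xc.
have E_split e : e \in E -> [\/ e = f, e = e0 | e \in R].
  move=> eE; case: (eqVneq e f) => [->|ef]; first by constructor.
  case: (eqVneq e e0) => [->|ee0]; first by constructor.
  by constructor 3; rewrite !inE ee0 eE others.
(* In no listed edge, [find] would return [size s]; covering rules this out. *)
have col5 x j : (size s <= j)%N -> col x != j.+4.
  move=> sj; have : x \in cover E by rewrite cov inE.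
  case/bigcupP=> e eE xe; rewrite /col.
  case: ifP => // _; case: ifP => // _; case: ifP => // /negbT xf; case: ifP => // /negbT xe0.
  rewrite !eqSS; have /E_split[ef|ee0|eR] := eE.
  - by rewrite -ef xe in xf.
  - by rewrite -ee0 xe in xe0.
  have: has (fun e : {set 'I_n} => x \in e) s by apply/hasP; exists e; rewrite ?mem_enum.
  by rewrite has_find; apply: contraTneq => ->; rewrite -leqNgt.
have pat0 : e0 = [set x | edge_pattern 0 (col x)].
  apply/setP=> x; rewrite inE /=.
  have -> : (col x < 3)%N = [|| col x == 0%N, col x == 1%N | col x == 2%N].
    by case: (col x) => [|[|[|]]].
  rewrite colc colu col2; case: (eqVneq x c) => [->//|_]; case: (eqVneq x u) => [->//|_].
  by rewrite !andbT.
have pat1 : f = [set x | edge_pattern 1 (col x)].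
  apply/setP=> x; rewrite inE /= colu col3; case: (eqVneq x u) => [->//|_].
  by rewrite andbT.
have pat2 j : (j < size s)%N -> nth set0 s j = [set x | edge_pattern j.+2 (col x)].
  move=> js; apply/setP=> x; rewrite inE /= colc col4//.
  by case: (eqVneq x c) => [->|_]; rewrite ?andbT//; have [] := R_E _ (sR j js).
exists col; split.
  case=> [|[|[|[|j]]]] /=.
  - by rewrite -[RHS](cards1 c); apply: eq_card => x; rewrite !inE colc.
  - by rewrite -[RHS](cards1 u); apply: eq_card => x; rewrite !inE colu.
  - rewrite -(unif e0 e0E) (cardD1 c e0) ce0 [in RHS](cardD1 u) !inE uc ue0 /=.
    by apply: eq_card => x; rewrite !inE col2; case: (x \in e0); case: (x == c); case: (x == u).
  - rewrite -(unif f fE) (cardD1 u f) uf /=.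
    by apply: eq_card => x; rewrite !inE col3 andbC.
  rewrite -size_s; case: ltnP => js.
    have [eE ce _] := R_E _ (sR j js); rewrite -(unif _ eE) [in RHS](cardD1 c) ce /=.
    by apply: eq_card => x; rewrite !inE col4// andbC.
  by apply: eq_card0 => x; rewrite !inE (negbTE (col5 x j js)).
move=> e; split.
  case/E_split => [->|->|eR]; [by exists 1%N; rewrite // m2 | by exists 0%N; rewrite // m2 |].
  have es : e \in s by rewrite mem_enum.
  exists (index e s).+2; first by rewrite m2 !ltnS index_mem.
  by rewrite -pat2 ?index_mem// nth_index.
case=> -[|[|j]] jm ->; rewrite -?pat0 -?pat1//.
have js : (j < size s)%N by rewrite m2 in jm.
by rewrite -pat2//; have [] := R_E _ (sR j js).
Qed.

(** Equal class sizes make the two lists of colours permutations of each other. *)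
Lemma coloring_perm n (colG colS : 'I_n -> nat) :
  (forall j, #|[set x | colG x == j]| = #|[set x | colS x == j]|) ->
  exists s : {perm 'I_n}, forall x, colS (s x) = colG x.
Proof.
move=> same; have cnt (col : 'I_n -> nat) j :
    count_mem j [tuple col i | i < n] = #|[set x | col x == j]|.
  rewrite cardE size_filter /= count_map -enumT /=.
  by apply: eq_count => x; rewrite !inE.
have /tuple_permP[s sP] : perm_eq [tuple colG i | i < n] [tuple colS i | i < n].
  by apply/allP=> j _; rewrite /= !cnt same.
exists s => x.
have /(congr1 (fun t => nth 0%N t x)) := sP.
by rewrite -!tnth_nth !tnth_mktuple.
Qed.

(** A colour-preserving permutation sends each edge to the one with the same pattern; equal edge
    counts turn the inclusion into equality. *)
Lemma near_star_iso n k (G S : {set {set 'I_n}}) c u e f c' u' e' f' :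
  ~ berge_cycle G -> ~ berge_cycle S -> uniform k G -> uniform k S ->
  cover G = setT -> cover S = setT -> #|G| = #|S| ->
  near_star G c u e f -> near_star S c' u' e' f' -> hiso G S.
Proof.
move=> aG aS uG uS cG cS GS nG nS.
have [colG [cntG edgeG]] := near_star_coloring aG uG cG nG.
have [colS [cntS edgeS]] := near_star_coloring aS uS cS nS.
have [|s sP] := @coloring_perm n colG colS; first by move=> j; rewrite cntG cntS GS.
exists s; apply/esym/eqP; rewrite eqEcard card_imset ?GS ?leqnn ?andbT; last first.
  exact: imset_inj perm_inj.
apply/subsetP=> _ /imsetP[g /edgeG[j jG ->] ->].
apply/edgeS; exists j; first by rewrite -GS.
apply/setP=> x; rewrite inE -[x](permKV s) mem_imset ?inE ?sP//; exact: perm_inj.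
Qed.

(** * Invariance of the spectral radius under isomorphism *)

Lemma hiso_sym n (G S : {set {set 'I_n}}) : hiso G S -> hiso S G.
Proof.
case=> s ->; exists (s^-1)%g; rewrite -imset_comp -[LHS]imset_id; apply: eq_imset => e /=.
by rewrite -imset_comp -[LHS]imset_id; apply: eq_imset => x /=; rewrite permK.
Qed.

Lemma hiso_eigenvalue n (G S : {set {set 'I_n}}) (a : algC) :
  hiso G S -> eigenvalue (adjmx G) a -> eigenvalue (adjmx S) a.
Proof.
case=> s -> {S}; set S := [set _ | _ in _].
have adjS i j : adjmx S (s i) (s j) = adjmx G i j.
  rewrite !mxE (inj_eq perm_inj); case: eqP => // _.
  rewrite big_mkcondr /= big_imset /=; last by move=> e f _ _; apply: imset_inj perm_inj _ _.
  rewrite [RHS]big_mkcondr; apply: eq_bigr => e _.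
  by rewrite !mem_imset ?card_imset//; apply: perm_inj.
case/eigenvalueP=> u uG u0; pose w := \row_j u 0 ((s^-1)%g j).
apply/eigenvalueP; exists w.
  apply/rowP=> j; rewrite -[j](permKV s) !mxE permK.
  move/rowP/(_ ((s^-1)%g j)): uG; rewrite !mxE => <-.
  rewrite (reindex_inj (@perm_inj _ s)) /=; apply: eq_bigr => i _.
  by rewrite adjS mxE permK.
apply: contraNneq u0 => w0; apply/eqP/rowP=> i.
by move/rowP/(_ (s i)): w0; rewrite !mxE permK.
Qed.

Lemma hiso_spectral_radius n (G S : {set {set 'I_n}}) (r t : algC) :
  hiso G S -> is_spectral_radius (adjmx G) r -> is_spectral_radius (adjmx S) t -> r = t.
Proof.
move=> GS [[a [aG <-]] Gmax] [[b [bS <-]] Smax]; apply/eqP; rewrite eq_le.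
rewrite Smax ?Gmax//; last exact: hiso_eigenvalue GS aG.
exact: hiso_eigenvalue (hiso_sym GS) bS.
Qed.

(** * Recognising near-stars, and comparing radii *)

Lemma double_hyperstar_near_star n k l (S : {set {set 'I_n}}) :
  double_hyperstar k l 1 S -> exists c u e f, near_star S c u e f.
Proof.
case=> _ _ [e [u1 [u2 [[eS u1e u2e u12] [_ /eqP/cards1P[f A2f] SE _ _]]]]].
have : f \in [set f] by rewrite inE.
rewrite -{1}A2f !inE => /and3P[fS fe u2f].
exists u1, u2, e, f; split; first by apply/two_pathsP; split=> //; split=> //; rewrite eq_sym.
move=> g; rewrite {1}SE A2f !inE => /orP[/eqP -> //|/orP[/and3P[]//|/eqP ->]].
by rewrite eqxx.
Qed.

(** Exactly one edge [f] misses [c]; by connectedness another edge meets [f], and that edge contains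
    [c]. *)
Lemma degree_near_star n (G : {set {set 'I_n}}) (c : 'I_n) :
  hconnected G -> (forall e, e \in G -> 2 <= #|e|)%N -> (#|incident G c|.+1 = #|G|)%N ->
  exists u e f, near_star G c u e f.
Proof.
move=> conn big dc.
have sub : incident G c \subset G by apply/subsetP=> e; rewrite inE => /andP[].
have /cards1P[f Gf] : #|G :\: incident G c| == 1%N.
  by rewrite cardsD (setIidPr sub) -dc subSnn.
have : f \in [set f] by rewrite inE.
rewrite -{1}Gf !inE => /andP[cf fG]; rewrite fG /= in cf.
have others e : e \in G -> e != f -> c \in e.
  move=> eG; apply: contraNT => ce.
  by rewrite -in_set1 -Gf !inE eG ce.
have [x xf] : exists x, x \in f by apply/card_gt0P; apply: ltnW; apply: big.
have [e [eG /pred0Pn[u /andP[/= ue uf]] nsub]] := connected_leave conn xf cf.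
have ef : e != f by apply: contraNneq nsub => ->.
exists u, e, f; split=> //; apply/two_pathsP; split=> //; last by rewrite eq_sym.
by split=> //; [apply: others | apply: contraNneq cf => <-].
Qed.

(** [th] is the larger root of [X^2 - k X - c]. *)
Lemma star_root (k c : nat) : (0 < k)%N ->
  exists th : algC, [/\ 0 < th, th ^+ 2 - k%:R * th = c%:R &
    forall t : algC, 0 <= t -> t ^+ 2 - k%:R * t <= c%:R -> t <= th].
Proof.
move=> k0; pose d : algC := (k ^ 2 + 4 * c)%:R; pose th := (k%:R + sqrtC d) / 2%:R.
have d0 : 0 <= d by rewrite ler0n.
have s0 : 0 <= sqrtC d by rewrite sqrtC_ge0.
have th2 : th * 2%:R = k%:R + sqrtC d by rewrite divfK// pnatr_eq0.
have th0 : 0 < th by rewrite divr_gt0 ?ltr0n// ltr_wpDr// ltr0n.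
have thE : th ^+ 2 - k%:R * th = c%:R.
  apply: (mulIf (_ : 4%:R != 0 :> algC)); first by rewrite pnatr_eq0.
  have -> : (th ^+ 2 - k%:R * th) * 4%:R = (th * 2%:R) ^+ 2 - k%:R * (th * 2%:R) * 2%:R by ring.
  rewrite th2 -natrM.
  have -> : (k%:R + sqrtC d) ^+ 2 - k%:R * (k%:R + sqrtC d) * 2%:R = sqrtC d ^+ 2 - k%:R ^+ 2 by ring.
  by rewrite sqrtCK /d natrD natrX addrC addKr mulnC.
exists th; split=> // t t0 tle; rewrite real_leNgt ?ger0_real ?(ltW th0)//; apply/negP => tht.
(* The product is the difference of the values of [X^2 - k X] at [t] and [th]; its second factor is
   positive because [2 th - k] is the square root of [d]. *)
have pos : 0 < (t - th) * ((t - th) + (th * 2%:R - k%:R)).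
  by rewrite mulr_gt0 ?subr_gt0// ltr_wpDr ?subr_gt0// th2 addrC addKr.
suff le0 : (t - th) * ((t - th) + (th * 2%:R - k%:R)) <= 0.
  by have := lt_le_trans pos le0; rewrite ltxx.
have -> : (t - th) * ((t - th) + (th * 2%:R - k%:R)) =
  (t ^+ 2 - k%:R * t) - (th ^+ 2 - k%:R * th) by ring.
by rewrite thE subr_le0.
Qed.

Theorem theorem1p2 (n k : nat) (G S : {set {set 'I_n}}) :
  (3 <= k)%N -> supertree G -> uniform k G -> (3 <= #|G|)%N ->
  (forall T, superstar k T -> ~ hiso G T) ->
  double_hyperstar k ((n - 1) %/ (k - 1) - 2)%N 1 S ->
  exists rG rS : algC,
    [/\ is_spectral_radius (adjmx G) rG, is_spectral_radius (adjmx S) rS,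
        rG <= rS & (rG = rS <-> hiso G S)].
Proof.
(* The edge size becomes [k.+3], so the spectral lemmas are used with parameter [k.+1]. *)
case: k => [|[|[|k]]] // _ treeG unifG m3 nostar dhS.
have [c' [u' [e' [f' nsS]]]] := double_hyperstar_near_star dhS.
case: dhS => treeS unifS _.
have G0 : G != set0 by rewrite -card_gt0; apply: leq_trans m3.
have S0 : S != set0.
  by case: nsS => /two_pathsP[[eS _ _ _] _ _ _] _; apply/set0Pn; exists e'.
have GS : #|G| = #|S|.
  apply/eqP; rewrite -(eqn_pmul2r (m := k.+2))// -(eqn_add2r 1).
  by rewrite -(supertree_order treeG unifG)// -(supertree_order treeS unifS).
case: (treeG) => -[n0 bigG] connG acycG; case: (treeS) => -[_ bigS] connS acycS.
have covG := cover_connected connG G0 bigG; have covS := cover_connected connS S0 bigS.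
have [rG rGP] := spectral_radius_exists (adjmx G) n0.
have [rS rSP] := spectral_radius_exists (adjmx S) n0.
exists rG, rS.
case: (boolP [exists c, #|incident G c|.+1 == #|G|]) => [/existsP[c /eqP dc]|/existsPn nodeg].
  have [u [e [f nsG]]] := degree_near_star connG bigG dc.
  have iso := near_star_iso acycG acycS unifG unifS covG covS GS nsG nsS.
  have eq_r := hiso_spectral_radius iso rGP rSP.
  by split=> //; rewrite eq_r.
have deg v : (#|incident G v| + 2 <= #|G|)%N.
  have sub : incident G v \subset G by apply/subsetP=> e; rewrite inE => /andP[].
  have ne1 := nodeg v; rewrite addn2 ltn_neqAle ne1 /= ltn_neqAle subset_leq_card// andbT.
  (* A vertex in every edge would make [G] a superstar, isomorphic to itself by the identity. *)
  apply/negP=> /eqP eq; have inc : incident G v = G by apply/eqP; rewrite eqEcard sub eq /=.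
  apply: (nostar G).
    by split=> //; exists v => e; rewrite -inc inE => /andP[].
  by exists 1%g; rewrite -[LHS]imset_id; apply: eq_imset => e /=; rewrite -[LHS]imset_id;
    apply: eq_imset => x; rewrite perm1.
(* This [th] separates the radii: [k.+2 * rG <= th < k.+2 * rS]. *)
have [th [th0 thE thmax]] := star_root (k.+2 * #|G|.-1) (ltn0Sn k).
have ltr : rG < rS.
  have kpos : 0 < k.+2%:R :> algC by rewrite ltr0n.
  rewrite -(ltr_pM2l kpos); apply: le_lt_trans (_ : th < _); last first.
    by apply: (near_star_radius_gt acycS unifS covS nsS rSP th0); rewrite thE GS.
  case: rGP => -[a [aP <-]] _; apply: thmax; first by rewrite mulr_ge0 ?ler0n.
  apply: (eigenvalue_weight_bound unifG (y := cweight G)) => //.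
  by move=> v; apply: (cweight_bound acycG unifG deg).
split=> //; first exact: ltW.
split=> [eq|iso]; first by rewrite eq ltxx in ltr.
exact: hiso_spectral_radius iso rGP rSP.
Qed.
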